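(* Let $G$ be a trust-and-coordination game with subgames $G_1,\dots,G_n$. If (a) $\arg\max_k v_2^{\mathrm{SE}}(G_k)\cap\arg\max_k v_1^{\mathrm{SE}}(G_k)=\emptyset$, and (b) the Nash equilibrium payoffs $\mathrm H_2^k$ of player 2 in the subgames $G_k$ are sufficiently low relative to the other payoffs in $G$, then enabling mixed-strategy simulation introduces Pareto-improving Nash equilibria in $G$. Here (b) means: for all other payoffs of $G$ held fixed (and satisfying (a)), there is a constant $K$ such that the conclusion holds whenever $\mathrm H_2^k\le K$ for all $k$.
   Context: A two-player normal-form game (NFG) $G=(S_1,S_2,u)$ has nonempty finite pure strategy sets and $u=(u_1,u_2):S_1\times S_2\to\mathbb R^2$. $\Sigma_i=\Delta(S_i)$, $u$ is extended by expectation, $\mathrm{NE}(G)$ is the set of Nash equilibria. For $\sigma_2\in\Sigma_2$, $\mathrm{br}(\sigma_2)\subseteq S_1$ is the set of pure best responses of player 1 and $\text{f-br}(\sigma_2)=\arg\max_{t_1\in \mathrm{br}(\sigma_2)}u_2(t_1,\sigma_2)$. Trust-and-coordination game: in the first stage the players simultaneously select actions, player $i$ from $\{a_i^1,\dots,a_i^n,\mathrm{OO}\}$. If they select $(a_1^k,a_2^l)$ with $k\ne l$, payoffs are $(\mathrm B_1,\mathrm B_2)$. If at least one player selects $\mathrm{OO}$, payoffs are $(\mathrm B_1,\mathrm B_2)$ plus an additional reward $\epsilon>0$ for (each of) the player(s) who used $\mathrm{OO}$. If they select $(a_1^k,a_2^k)$, they enter a second stage and play the $2\times2$ game $G_k$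 with actions $\{\mathrm T,\mathrm{WO}\}$ for player 1 and $\{\mathrm C,\mathrm D\}$ for player 2 and payoffs $$u^{G_k}(\mathrm T,\mathrm C)=(\mathrm G_1^k,\mathrm G_2^k),\quad u^{G_k}(\mathrm T,\mathrm D)=(\mathrm H_1^k,\mathrm A_2^k),\quad u^{G_k}(\mathrm{WO},\mathrm C)=u^{G_k}(\mathrm{WO},\mathrm D)=(\mathrm N_1^k,\mathrm H_2^k),$$ where $\mathrm H_1^k<\mathrm B_1<\mathrm B_1+\epsilon<\mathrm N_1^k<\mathrm G_1^k$ and $\mathrm H_2^k<\mathrm B_2<\mathrm B_2+\epsilon<\mathrm G_2^k<\mathrm A_2^k$ for every $k$. This two-stage game is viewed as a normal-form game in the standard way. $v_i^{\mathrm{SE}}(G_k)$ is player $i$'s expected utility in the Stackelberg equilibrium of $G_k$ with player 2 as leader: player 2 commits to a mixed strategy $\sigma_2$ in $G_k$ maximising $u_2(\text{f-br}(\sigma_2),\sigma_2)$, and player 1 plays a favourable best response (ties broken in the leader's favour). For a simulation cost $c>0$, the mixed-strategy simulation game $G^c_{\text{m-sim}}$ is the (infinite) NFG in which player 1's pure strategies are $S_1\cup\{\text{m-sim}\}$, player 2's pure strategies are $\Sigma_2$, $u(s_1,\sigma_2)$ is as in $G$ for $s_1\in S_1$, and $$u_1(\text{m-sim},\sigma_2)=u_1(\mathrm{br}(\sigma_2),\sigma_2)-c,\qquad u_2(\text{m-sim},\sigma_2)=u_2(\text{f-br}(\sigma_2),\sigma_2).$$ Mixed strategies of player 2 in $G^c_{\text{m-sim}}$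 are (Borel) probability distributions over $\Sigma_2$; Nash equilibria are defined as usual. ''Enabling mixed-strategy simulation introduces Pareto-improving Nash equilibria in $G$'' means: there is $c_0>0$ such that for every $0<c<c_0$ the game $G^c_{\text{m-sim}}$ has a Nash equilibrium $\mu^*$ with $u_i(\mu^* )>u_i(\sigma)$ for both $i\in\{1,2\}$ and every $\sigma\in\mathrm{NE}(G)$. *)

(* Defs.v *)
From HB Require Import structures.
From mathcomp Require Import all_boot all_order all_algebra.
From mathcomp Require Import all_classical all_reals all_analysis.
Import Order.TTheory GRing.Theory Num.Theory numFieldNormedType.Exports.

Set Implicit Arguments.
Unset Strict Implicit.
Unset Printing Implicit Defensive.

Local Open Scope ring_scope.

Definition simplex (R : realType) (S : finType) : set {ptws S -> R} :=
  [set p : S -> R | (forall s, 0 <= p s) /\ \sum_s p s = 1]%classic.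
Arguments simplex : clear implicits.

(* [simplex R S] is coerced to a type by [set_type], which carries the subspace
   topology inherited from the product topology on [S -> R]. *)
Definition mixed (R : realType) (S : finType) : Type := simplex R S.

Definition prob_of (R : realType) (S : finType) (p : mixed R S) : S -> R :=
  set_val p.
Coercion prob_of : mixed >-> Funclass.

Definition argmax (R : realType) (I : finType) (f : I -> R) : {set I} :=
  [set i | [forall j, f j <= f i]].

(* The value of [f] at an element of [A]; only used for [A] nonempty and [f]
   constant on [A], so that the choice of the element is immaterial. *)
Definition value_on (R : realType) (I : finType) (A : {set I}) (f : I -> R) : R :=
  if [pick i in A] is Some i then f i else 0.

Record nfg (R : realType) := NFG {
  strat1 : finType;
  strat2 : finType;
  strat1_gt0 : (0 < #|strat1|)%N;
  strat2_gt0 : (0 < #|strat2|)%N;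
  pay1 : strat1 -> strat2 -> R;
  pay2 : strat1 -> strat2 -> R }.

Definition mixed2 (R : realType) (G : nfg R) : Type := mixed R (strat2 G).

Section NormalFormGame.
Context {R : realType} (G : nfg R).
Implicit Types (s : strat1 G) (p : mixed R (strat1 G)) (q : mixed R (strat2 G)).

Definition upure1 s q : R := \sum_s2 q s2 * pay1 s s2.
Definition upure2 s q : R := \sum_s2 q s2 * pay2 s s2.

Definition u1 p q : R := \sum_s p s * upure1 s q.
Definition u2 p q : R := \sum_s p s * upure2 s q.

Definition is_NE p q : Prop :=
  (forall p' : mixed R (strat1 G), u1 p' q <= u1 p q) /\
  (forall q' : mixed R (strat2 G), u2 p q' <= u2 p q).

Definition br q : {set strat1 G} := argmax (fun s => upure1 s q).

Definition fbr q : {set strat1 G} :=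
  [set s in br q | [forall t in br q, upure2 t q <= upure2 s q]].

Definition u1_br q : R := value_on (br q) (fun s => upure1 s q).
Definition u1_fbr q : R := value_on (fbr q) (fun s => upure1 s q).
Definition u2_fbr q : R := value_on (fbr q) (fun s => upure2 s q).

Definition SE_commitment q : Prop :=
  forall q' : mixed R (strat2 G), u2_fbr q' <= u2_fbr q.

(* For a general game, [v1_SE] depends on which Stackelberg equilibrium is
   chosen; in the subgames below the optimal commitment is unique. *)
Definition v1_SE : R :=
  xget 0 [set v | exists2 q, SE_commitment q & v = u1_fbr q]%classic.
Definition v2_SE : R :=
  xget 0 [set v | exists2 q, SE_commitment q & v = u2_fbr q]%classic.

End NormalFormGame.

Section MixedTopology.
Context {R : realType} (G : nfg R).

Lemma mixed2_inhabited : exists p : mixed2 G, True.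
Proof.
have /card_gt0P[s _] := strat2_gt0 G.
pose d (t : strat2 G) : R := (t == s)%:R.
have dP : d \in simplex R (strat2 G).
  rewrite inE; split=> [t|]; first exact: ler0n.
  by rewrite (bigD1 s) //= big1 ?addr0 /d ?eqxx // => t /negPf ->.
by exists (exist _ d dP).
Qed.

HB.instance Definition _ := Topological.copy (mixed2 G) (set_type (simplex R (strat2 G))).
(* The library requires measurable types to be pointed. *)
HB.instance Definition _ := isPointed.Build (mixed2 G)
  (projT1 (cid mixed2_inhabited)).

Definition borel_mixed2 := g_sigma_algebraType (@open (mixed2 G)).

End MixedTopology.

Section MixedSimulation.
Context {R : realType} (G : nfg R) (c : R).

(* [None] is the strategy m-sim. *)
Definition msim_pay1 (s : option (strat1 G)) (q : mixed R (strat2 G)) : R :=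
  if s is Some s1 then upure1 s1 q else u1_br q - c.
Definition msim_pay2 (s : option (strat1 G)) (q : mixed R (strat2 G)) : R :=
  if s is Some s1 then upure2 s1 q else u2_fbr q.

Implicit Types (mu : mixed R (option (strat1 G))).
Implicit Types (nu : probability (borel_mixed2 G) R).

(* The integrands are bounded and Borel, so these are genuine expectations. *)
Definition msim_u1 mu nu : R :=
  \sum_s mu s * \int[nu]_(q in setT) msim_pay1 s q.
Definition msim_u2 mu nu : R :=
  \sum_s mu s * \int[nu]_(q in setT) msim_pay2 s q.

Definition msim_NE mu nu : Prop :=
  (forall mu' : mixed R (option (strat1 G)), msim_u1 mu' nu <= msim_u1 mu nu) /\
  (forall nu' : probability (borel_mixed2 G) R, msim_u2 mu nu' <= msim_u2 mu nu).

End MixedSimulation.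

Definition msim_pareto_improving (R : realType) (G : nfg R) : Prop :=
  exists2 c0 : R, 0 < c0 & forall c : R, 0 < c < c0 ->
    exists (mu : mixed R (option (strat1 G))) (nu : probability (borel_mixed2 G) R),
      msim_NE c mu nu /\
      forall (p : mixed R (strat1 G)) (q : mixed R (strat2 G)), is_NE p q ->
        u1 p q < msim_u1 c mu nu /\ u2 p q < msim_u2 mu nu.

(* All the payoffs of a trust-and-coordination game except the [H_2^k], which
   are kept apart because they are quantified separately. *)
Record tc_payoffs (R : realType) (n : nat) := TCPayoffs {
  tcB1 : R; tcB2 : R; tcE : R;
  tcG1 : 'I_n -> R; tcH1 : 'I_n -> R; tcN1 : 'I_n -> R;
  tcG2 : 'I_n -> R; tcA2 : 'I_n -> R }.

Section TrustAndCoordination.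
Context {R : realType} {n : nat} (P : tc_payoffs R n) (H2 : 'I_n -> R).

Definition tc_valid : Prop :=
  0 < tcE P /\
  forall k,
    [/\ tcH1 P k < tcB1 P, tcB1 P < tcB1 P + tcE P,
        tcB1 P + tcE P < tcN1 P k & tcN1 P k < tcG1 P k] /\
    [/\ H2 k < tcB2 P, tcB2 P < tcB2 P + tcE P,
        tcB2 P + tcE P < tcG2 P k & tcG2 P k < tcA2 P k].

(* Second stage, on booleans: [true] is T for player 1 and C for player 2,
   [false] is WO for player 1 and D for player 2. *)
Definition sub_pay1 (k : 'I_n) (t c : bool) : R :=
  if t then (if c then tcG1 P k else tcH1 P k) else tcN1 P k.
Definition sub_pay2 (k : 'I_n) (t c : bool) : R :=
  if t then (if c then tcG2 P k else tcA2 P k) else H2 k.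

Lemma bool_gt0 : (0 < #|{: bool}|)%N. Proof. by rewrite card_bool. Qed.

Definition subgame (k : 'I_n) : nfg R :=
  NFG bool_gt0 bool_gt0 (sub_pay1 k) (sub_pay2 k).

(* A pure strategy is a first-stage action ([None] is OO) together with a
   second-stage action for each subgame, on or off the path of play. *)
Definition tc_strat : finType := (option 'I_n * {ffun 'I_n -> bool})%type.

Lemma tc_strat_gt0 : (0 < #|tc_strat|)%N.
Proof. by apply/card_gt0P; exists (None, [ffun=> true]). Qed.

Definition oo_reward (a : option 'I_n) : R := if a is None then tcE P else 0.

Definition tc_pay1 (s1 s2 : tc_strat) : R :=
  match s1.1, s2.1 with
  | Some k, Some l => if k == l then sub_pay1 k (s1.2 k) (s2.2 k) else tcB1 P
  | _, _ => tcB1 P + oo_reward s1.1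
  end.
Definition tc_pay2 (s1 s2 : tc_strat) : R :=
  match s1.1, s2.1 with
  | Some k, Some l => if k == l then sub_pay2 k (s1.2 k) (s2.2 k) else tcB2 P
  | _, _ => tcB2 P + oo_reward s2.1
  end.

Definition tc_game : nfg R := NFG tc_strat_gt0 tc_strat_gt0 tc_pay1 tc_pay2.

End TrustAndCoordination.

(* Main.v *)
(* Let [v k] be the leader's Stackelberg value of the [k]-th subgame; it does not
   involve [H2].  By (a) there are at least two subgames; let [a] maximise [v], and
   let [b] maximise [v] among the others.  In the equilibrium, player 2
   commits to the Stackelberg strategy of [a] with probability [1 - y] and to that
   of [b] with probability [y], while player 1 simulates with probability [1 - x]
   and plays [(a, WO)] with probability [x].  Simulating is worth its cost exactly
   when [y = c / (N1 b - B1)], which tends to 0 with [c].  Player 2 is indifferent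
   when [(1 - x) v a + x H2 a = (1 - x) v b + x B2]; as [H2 a] decreases, [x] tends
   to 0, so that this common value exceeds [B2 + epsilon], a bound on player 2's
   payoff in every Nash equilibrium of the original game, where player 2 always
   plays OO. *)

Require Import Defs.
From HB Require Import structures.
From mathcomp Require Import all_boot all_order all_algebra.
From mathcomp Require Import all_classical all_reals all_analysis measurable_realfun.
From mathcomp Require Import ring lra.
Import Order.TTheory GRing.Theory Num.Theory numFieldNormedType.Exports.

Set Implicit Arguments.
Unset Strict Implicit.
Unset Printing Implicit Defensive.

Local Open Scope ring_scope.

(** * Two-point probability measures and their integrals *)

Section Mixture.
Context d (T : measurableType d) (R : realType) (a b : T) (y z : {nonneg R}).
Hypothesis yz1 : y%:num + z%:num = 1.

Let mixture : set T -> \bar R :=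
  measure_add (mscale y (dirac a)) (mscale z (dirac b)).

HB.instance Definition _ := Measure.on mixture.

Let mixture_setT : mixture setT = 1%E.
Proof.
transitivity (y%:num%:E * \d_a setT + z%:num%:E * \d_b setT)%E.
  by rewrite /mixture measure_addE.
by rewrite !diracT !mule1 -EFinD yz1.
Qed.

HB.instance Definition _ := Measure_isProbability.Build _ _ _ mixture mixture_setT.

Definition two_point_prob : probability T R := mixture.

(** Additivity of the integral in the measure is applied to nonnegative integrands; the real case
    follows by splitting [f] into positive and negative parts. *)
Lemma Rintegral_two_point_prob (f : T -> R) : measurable_fun setT f ->
  \int[two_point_prob]_x f x = y%:num * f a + z%:num * f b.
Proof.
move=> mf; have /measurable_EFinP mEf := mf.
have ge0 (g : T -> \bar R) : measurable_fun [set: T] g -> (forall x, 0 <= g x)%E ->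
    (\int[mixture]_x g x = y%:num%:E * g a + z%:num%:E * g b)%E.
  move=> mg g0; rewrite /mixture ge0_integral_measure_add//.
  by rewrite !ge0_integral_mscale// !integral_dirac// !diracT !mul1e.
have fE x : f x = Num.max (f x) 0 - Num.max (- f x) 0.
  by rewrite /Num.max; do 2 case: ifP; lra.
rewrite /Rintegral integralE !ge0//; first last.
- exact: measurable_funepos.
- exact: measurable_funeneg.
rewrite !funeposE !funenegE /= -!EFin_max -!EFinM -!EFinD /=.
by rewrite [in RHS](fE a) [in RHS](fE b); ring.
Qed.

End Mixture.

(** * Borel measurability of the payoffs of the simulation game *)

Section BorelMeasurability.
Context (R : realType) (G : nfg R).
Local Notation Q := (borel_mixed2 G).

(** The topology is initial for the inclusion into the product, so a coordinate is continuous and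
    pulls open intervals back to generators of the sigma-algebra. *)
Lemma measurable_weight (s : strat2 G) :
  measurable_fun setT (fun q : Q => prob_of q s).
Proof.
apply: (measurability _ (RGenOpens.measurableE R)).
move=> _ [_ [a [b ->]] <-]; rewrite setTI.
apply: sub_sigma_algebra.
have cs : continuous (fun q : mixed2 G => prob_of q s).
  move=> q; apply: (@continuous_comp _ _ _ _ (fun p : {ptws strat2 G -> R} => p s)).
    exact: initial_continuous.
  exact: (@proj_continuous (strat2 G) (fun=> R) s).
exact: (open_comp _ (@interval_open _ _ _ _ _)).
Qed.

Lemma measurable_upure1 (s : strat1 G) : measurable_fun setT (upure1 s : Q -> R).
Proof.
apply: measurable_sum => t; apply: measurable_funM => //.
exact: measurable_weight.
Qed.

Lemma measurable_upure2 (s : strat1 G) : measurable_fun setT (upure2 s : Q -> R).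
Proof.
apply: measurable_sum => t; apply: measurable_funM => //.
exact: measurable_weight.
Qed.

Lemma measurable_le_set (f g : Q -> R) : measurable_fun setT f ->
  measurable_fun setT g -> measurable [set q | f q <= g q]%classic.
Proof.
move=> mf mg; rewrite -[X in measurable X]setTI.
exact: (measurable_fun_ler mf mg measurableT (Y := [set true]%classic)).
Qed.

Lemma measurable_forall (T : finType) (p : T -> Q -> bool) :
  (forall t, measurable [set q | p t q]%classic) ->
  measurable [set q | [forall t, p t q]]%classic.
Proof.
move=> mp; rewrite (_ : mkset _ = \bigcap_(t in setT) [set q | p t q])%classic.
  exact: fin_bigcap_measurable.
apply/seteqP; split=> q /= => [/forallP pq t _|pq]; first exact: pq.
by apply/forallP => t; exact: pq.
Qed.

Lemma measurable_br (s : strat1 G) : measurable [set q : Q | s \in br q]%classic.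
Proof.
rewrite (_ : mkset _ = [set q : Q | [forall t, upure1 t q <= upure1 s q]])%classic.
  apply: measurable_forall => t.
  by apply: measurable_le_set; exact: measurable_upure1.
by apply/seteqP; split=> q /=; rewrite !inE.
Qed.

Lemma measurable_fbr (s : strat1 G) : measurable [set q : Q | s \in fbr q]%classic.
Proof.
rewrite (_ : mkset _ = [set q : Q | s \in br q] `&`
  [set q : Q | [forall t, (t \in br q) ==> (upure2 t q <= upure2 s q)]])%classic.
  apply: measurableI; first exact: measurable_br.
  apply: measurable_forall => t.
  rewrite (_ : mkset _ = ~` [set q : Q | t \in br q] `|`
      [set q : Q | upure2 t q <= upure2 s q])%classic; last first.
    apply/seteqP; split=> q /=; last by case=> [/negP/negPf ->//|->]; rewrite implybT.
    by case: (t \in br q) => /=; [right|left].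
  apply: measurableU; first by apply: measurableC; exact: measurable_br.
  by apply: measurable_le_set; exact: measurable_upure2.
by apply/seteqP; split=> q /=; rewrite !inE => /andP.
Qed.

(* A finite set varying measurably takes finitely many values; on the event that
   it equals [A], the picked element is fixed. *)
Lemma measurable_value_on (T : finType) (F : Q -> {set T}) (g : T -> Q -> R) :
  (forall t, measurable [set q | t \in F q]%classic) ->
  (forall t, measurable_fun setT (g t)) ->
  measurable_fun setT (fun q => value_on (F q) (g ^~ q)).
Proof.
move=> mF mg.
rewrite (_ : (fun q => _) = fun q => \sum_(A : {set T})
    \1_[set q | [forall t, (t \in F q) == (t \in A)]]%classic q
      * value_on A (g ^~ q)).
  apply: measurable_sum => A; apply: measurable_funM.
    apply: measurable_indic; apply: measurable_forall => t.
    rewrite (_ : mkset _ = if t \in A then [set q | t \in F q]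
      else ~` [set q | t \in F q])%classic; last first.
      apply/seteqP; split=> q /=; case: (t \in A) => /=.
    - by move/eqP.
    - by move/eqP => ->.
    - by move=> ->.
    - by move/negP/negPf => ->.
    by case: ifP => _; [exact: mF|apply: measurableC; exact: mF].
  by rewrite /value_on; case: pickP.
apply/funext => q; rewrite (bigD1 (F q)) //= big1 ?addr0 => [|A AF].
  rewrite indicE mem_set ?mul1r//=; apply/forallP => t; exact: eqxx.
rewrite indicE memNset ?mul0r//= => /forallP FA.
by case/negP: AF; apply/eqP/setP => t; rewrite (eqP (FA t)).
Qed.

Lemma measurable_u1_br : measurable_fun setT (@u1_br R G : Q -> R).
Proof. exact: measurable_value_on measurable_br measurable_upure1. Qed.

Lemma measurable_u2_fbr : measurable_fun setT (@u2_fbr R G : Q -> R).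
Proof. exact: measurable_value_on measurable_fbr measurable_upure2. Qed.

Lemma measurable_msim_pay1 c s : measurable_fun setT (msim_pay1 c s : Q -> R).
Proof.
case: s => [s|]; first exact: measurable_upure1.
by apply: measurable_funB => //; exact: measurable_u1_br.
Qed.

Lemma measurable_msim_pay2 s : measurable_fun setT (msim_pay2 s : Q -> R).
Proof.
by case: s => [s|]; [exact: measurable_upure2|exact: measurable_u2_fbr].
Qed.

End BorelMeasurability.

(** * Averages under finite mixed strategies *)

Section MixedStrategies.
Context (R : realType) (S : finType).
Implicit Types (p : mixed R S) (F : S -> R).

Lemma mixed_ge0 p s : 0 <= p s.
Proof. by have [p0 _] := set_mem (svalP p); exact: p0. Qed.

Lemma mixed_sum1 p : \sum_s p s = 1.
Proof. by have [_] := set_mem (svalP p). Qed.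

(** The strategy is described by its expectations, the only form in which it is used. The case
    [s = t] is allowed and yields pure strategies. *)
Lemma two_point_mixed (l : R) (s t : S) : 0 <= l <= 1 ->
  exists p, forall F, \sum_x p x * F x = l * F s + (1 - l) * F t.
Proof.
move=> /andP[l0 l1].
pose d x : R := l * (x == s)%:R + (1 - l) * (x == t)%:R.
have dF F : \sum_x d x * F x = l * F s + (1 - l) * F t.
  under eq_bigr do rewrite mulrDl -!mulrA.
  rewrite big_split -!mulr_sumr /= (bigD1 s)//= (bigD1 t (P := xpredT))//= !eqxx.
  rewrite !big1 => [|x /negPf ->|x /negPf ->]; rewrite ?mul0r//.
  by rewrite !addr0 !mul1r.
have dP : d \in simplex R S.
  rewrite inE; split=> [x|].
    by rewrite addr_ge0// mulr_ge0 ?ler0n// subr_ge0.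
  by under eq_bigr do rewrite -[d _]mulr1; rewrite (dF (fun=> 1)); ring.
by exists (exist _ d dP).
Qed.

Lemma mixed_avg_le p F c : (forall s, p s != 0 -> F s <= c) ->
  \sum_s p s * F s <= c.
Proof.
move=> Fc; rewrite -[leRHS]mul1r -(mixed_sum1 p) mulr_suml ler_sum// => s _.
have [->|/Fc Fsc] := eqVneq (p s) 0; first by rewrite !mul0r.
by rewrite ler_wpM2l// mixed_ge0.
Qed.

Lemma mixed_avg_const p (c : R) : \sum_s p s * c = c.
Proof. by rewrite -mulr_suml mixed_sum1 mul1r. Qed.

Lemma mixed_avg_lt p (F F' : S -> R) s0 :
  (forall s, p s != 0 -> F s <= F' s) -> p s0 != 0 -> F s0 < F' s0 ->
  \sum_s p s * F s < \sum_s p s * F' s.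
Proof.
move=> FF' ps0 lt0; rewrite (bigD1 s0)//= [ltRHS](bigD1 s0)//= ltr_leD//.
  by rewrite ltr_pM2l// lt_def ps0 mixed_ge0.
apply: ler_sum => s _.
have [->|/FF' FF's] := eqVneq (p s) 0; first by rewrite !mul0r.
by rewrite ler_wpM2l// mixed_ge0.
Qed.

(** Each pure value is at most the optimal average, so a played [s] with [F s < F t] would make that
    average strictly smaller than itself. *)
Lemma mixed_optimal_support p F :
  (forall p', \sum_s p' s * F s <= \sum_s p s * F s) ->
  forall s t, p s != 0 -> F t <= F s.
Proof.
move=> opt s t ps; rewrite leNgt; apply/negP => Fst.
have avg u : F u <= \sum_s p s * F s.
  have [|p' p'E] := @two_point_mixed 1 u u; first by rewrite ler01 lexx.
  by apply: le_trans (opt p'); rewrite p'E; lra.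
have := @mixed_avg_lt p F (fun=> \sum_s p s * F s) s (fun u _ => avg u) ps
  (lt_le_trans Fst (avg t)).
by rewrite mixed_avg_const ltxx.
Qed.

Lemma exists_argmax (f : S -> R) (Q : pred S) (s0 : S) : Q s0 ->
  exists2 s, Q s & forall t, Q t -> f t <= f s.
Proof. by move=> Qs0; case: (arg_maxP f Qs0) => s Qs smax; exists s. Qed.

End MixedStrategies.

(** * Favourable best responses and player 2's deviations *)

Section BestResponses.
Context (R : realType) (G : nfg R).
Implicit Types (s : strat1 G) (q : mixed R (strat2 G)).

Lemma value_onE (T : finType) (A : {set T}) (f : T -> R) t :
  t \in A -> (forall u, u \in A -> f u = f t) -> value_on A f = f t.
Proof.
move=> tA fE; rewrite /value_on; case: pickP => [u /fE //|A0].
by have := A0 t; rewrite tA.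
Qed.

Lemma brP s q : reflect (forall t, upure1 t q <= upure1 s q) (s \in br q).
Proof. by rewrite inE; exact: forallP. Qed.

Lemma fbrP s q :
  reflect (s \in br q /\ forall t, t \in br q -> upure2 t q <= upure2 s q)
    (s \in fbr q).
Proof.
rewrite /fbr finset.in_set; apply: (iffP andP) => -[-> smax]; split=> //.
  by move=> t; exact: (implyP (forallP smax t)).
by apply/forallP => t; apply/implyP; exact: smax.
Qed.

Lemma u1_brE s q : s \in br q -> u1_br q = upure1 s q.
Proof.
move=> sbr; apply: value_onE => // t /brP tmax.
by apply/eqP; rewrite eq_le tmax andbT; move/brP: sbr; exact.
Qed.

Lemma u2_fbrE s q : s \in fbr q -> u2_fbr q = upure2 s q.
Proof.
move=> /fbrP[sbr smax]; apply: value_onE => [|t /fbrP[tbr tmax]].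
  by apply/fbrP; split.
by apply/eqP; rewrite eq_le tmax// smax.
Qed.

Lemma exists_fbr q : exists s, s \in fbr q.
Proof.
have /card_gt0P[s0 _] := strat1_gt0 G.
have [s1 _ s1max] := @exists_argmax R _ (fun s => upure1 s q) xpredT s0 isT.
have s1br : s1 \in br q by apply/brP => t; exact: s1max.
have [s sbr smax] := @exists_argmax R _ (fun s => upure2 s q) (mem (br q)) s1 s1br.
by exists s; apply/fbrP.
Qed.

(** Exchanging the sums displays player 2's payoff as an average under [q], the form to which
    [mixed_optimal_support] applies. *)
Lemma u2E (p : mixed R (strat1 G)) q :
  u2 p q = \sum_t q t * \sum_s p s * pay2 s t.
Proof.
rewrite /u2 /upure2; under eq_bigr do rewrite mulr_sumr.
rewrite exchange_big /=; apply: eq_bigr => t _; rewrite mulr_sumr.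
by apply: eq_bigr => s _; rewrite mulrCA.
Qed.

Lemma normr_upure2_le s q :
  `|upure2 s q| <= \sum_(s' : strat1 G) \sum_t `|pay2 s' t|.
Proof.
rewrite [leRHS](bigD1 s)//= -[leLHS]addr0 lerD//; last first.
  by apply: sumr_ge0 => s' _; exact: sumr_ge0.
apply: le_trans (ler_norm_sum _ _ _) _; apply: ler_sum => t _.
rewrite normrM ger0_norm ?mixed_ge0// ler_piMl//.
rewrite -(mixed_sum1 q) (bigD1 t)//= lerDl.
by apply: sumr_ge0 => u _; exact: mixed_ge0.
Qed.

Lemma normr_msim_pay2_le (o : option (strat1 G)) q :
  `|msim_pay2 o q| <= \sum_(s : strat1 G) \sum_t `|pay2 s t|.
Proof.
case: o => [s|] /=; first exact: normr_upure2_le.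
by have [s /u2_fbrE ->] := exists_fbr q; exact: normr_upure2_le.
Qed.

Lemma integrable_msim_pay2 (nu : probability (borel_mixed2 G) R)
    (o : option (strat1 G)) :
  nu.-integrable setT (EFin \o (msim_pay2 o : borel_mixed2 G -> R)).
Proof.
apply: measurable_bounded_integrable => //.
- exact: le_lt_trans (probability_le1 nu measurableT) (ltry _).
- exact: measurable_msim_pay2.
- exists (\sum_(s : strat1 G) \sum_t `|pay2 s t|); split; first exact: num_real.
  move=> M /ltW leM q _; apply: le_trans leM; exact: normr_msim_pay2_le.
Qed.

(** Reduces deviations to arbitrary Borel distributions to a bound on each single commitment, which
    survives integration against a probability. *)
Lemma Rintegral_msim_pay2_le (nu : probability (borel_mixed2 G) R) (x V : R) s :
  (forall q, (1 - x) * u2_fbr q + x * upure2 s q <= V) ->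
  (1 - x) * (\int[nu]_q msim_pay2 None q) + x * (\int[nu]_q msim_pay2 (Some s) q)
    <= V.
Proof.
move=> leV.
have int1 := integrable_msim_pay2 nu None.
have int2 := integrable_msim_pay2 nu (Some s).
rewrite -!RintegralZl// -RintegralD//; first last.
- exact: (integrableZl measurableT x int2).
- exact: (integrableZl measurableT (1 - x) int1).
have <- : \int[nu]_q V = V.
  rewrite Rintegral_cst// -[RHS]mulr1; congr (_ * _).
  exact: (congr1 fine (probability_setT nu)).
apply: le_Rintegral => //.
- exact: (integrableD measurableT (integrableZl measurableT (1 - x) int1)
    (integrableZl measurableT x int2)).
- apply: measurable_bounded_integrable => //.
    exact: le_lt_trans (probability_le1 nu measurableT) (ltry _).
  by exists `|V|; split; [exact: num_real|move=> M /ltW leM q _].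
- by move=> q _; exact: leV.
Qed.

End BestResponses.

(** * Equilibria and commitments in the trust-and-coordination game *)

Section TrustCoordination.
Context (R : realType) (n : nat) (P : tc_payoffs R n) (H2 : 'I_n -> R).
Hypothesis valid : tc_valid P H2.
Local Notation G := (tc_game P H2).

Definition set_second (b : bool) (k : 'I_n) (s : @tc_strat n) : @tc_strat n :=
  (s.1, [ffun j => if j == k then b else s.2 j]).

(** Suppose player 2 enters [k] with positive probability. If player 1 sometimes enters [k] with T,
    then D strictly beats C there, so player 2 never plays C in [k], and player 1 gains by walking
    out. If player 1 never does, entering [k] earns player 2 at most [tcB2 P], less than opting
    out. *)
Lemma tc_NE_second_OO (p : mixed R (strat1 G)) (q : mixed R (strat2 G)) :
  is_NE p q -> forall t, q t != 0 -> t.1 = None.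
Proof.
have [e0 vP] := valid.
move=> [opt1 opt2].
have br1 : forall s s', p s != 0 -> upure1 s' q <= upure1 s q.
  exact: mixed_optimal_support opt1.
have br2 : forall t t', q t != 0 ->
    \sum_s p s * tc_pay2 P H2 s t' <= \sum_s p s * tc_pay2 P H2 s t.
  by apply: mixed_optimal_support => q'; rewrite -!(@u2E R G); exact: opt2.
move=> [[k|//] g] qt; exfalso.
have [[h1 _ h2 h3] [h4 _ h5 h6]] := vP k.
have [[f [pf fk]]|noT] := pselect (exists f, p (Some k, f) != 0 /\ f k).
- have gD g' : q (Some k, g') != 0 -> g' k = false.
    move=> qg'; apply/negP => g'k.
    have := br2 _ (set_second false k (Some k, g')) qg'.
    apply/negP; rewrite -ltNge; apply: (mixed_avg_lt _ pf).
    + move=> [[j|] f'] _; rewrite /tc_pay2 //=.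
      case: ifP => // /eqP ->; rewrite ffunE eqxx /sub_pay2 g'k.
      by case: ifP => // _; exact: ltW.
    + by rewrite /tc_pay2 /= eqxx ffunE eqxx /sub_pay2 g'k fk.
  have := br1 _ (set_second false k (Some k, f)) pf.
  apply/negP; rewrite -ltNge; apply: (mixed_avg_lt _ qt).
  + move=> [[j|] g'] qg'; rewrite /= /tc_pay1 //=.
    case: ifP => // /eqP kj; rewrite ffunE eqxx /sub_pay1 fk.
    by rewrite -kj in qg'; rewrite gD//; lra.
  + by rewrite /= /tc_pay1 /= eqxx ffunE eqxx /sub_pay1 fk gD//; lra.
- have := br2 _ (None, g) qt; apply/negP; rewrite -ltNge.
  apply: (@le_lt_trans _ _ (tcB2 P)).
    apply: mixed_avg_le => -[[j|] f] pf; rewrite /tc_pay2 /=; last by rewrite addr0.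
    case: ifP => // /eqP jk; rewrite /sub_pay2.
    rewrite jk in pf *; case: ifP => fk; last exact: ltW.
    by case: noT; exists f.
  rewrite (eq_bigr (fun s => p s * (tcB2 P + tcE P))) => [|[[j|] f] _].
  + by rewrite mixed_avg_const ltrDl.
  + by rewrite /tc_pay2.
  + by rewrite /tc_pay2.
Qed.

(** Once player 2 always opts out, every pure outcome that occurs obeys these bounds. *)
Lemma tc_NE_payoffs (p : mixed R (strat1 G)) (q : mixed R (strat2 G)) :
  is_NE p q -> u1 p q <= tcB1 P + tcE P /\ u2 p q <= tcB2 P + tcE P.
Proof.
have [e0 _] := valid.
move=> /tc_NE_second_OO qOO; split; apply: mixed_avg_le => s _;
  apply: mixed_avg_le => t /qOO; case: s t => [[j|] f] [a g] /= ->.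
- by rewrite /tc_pay1 /= addr0 lerDl ltW.
- by rewrite /tc_pay1.
- by rewrite /tc_pay2.
- by rewrite /tc_pay2.
Qed.

(* The least probability of C making T a best response in the [k]-th subgame. *)
Definition trust_prob (k : 'I_n) : R :=
  (tcN1 P k - tcH1 P k) / (tcG1 P k - tcH1 P k).

(** Player 2's payoff when C has exactly this probability and player 1 trusts. It does not involve
    [H2], so the final constant can be chosen before [H2]. *)
Definition leader_value (k : 'I_n) : R :=
  trust_prob k * tcG2 P k + (1 - trust_prob k) * tcA2 P k.

Lemma trust_probE k :
  trust_prob k * tcG1 P k + (1 - trust_prob k) * tcH1 P k = tcN1 P k.
Proof.
have [[h1 h h2 h3] _] := valid.2 k; rewrite /trust_prob.
by field; rewrite subr_eq0 gt_eqF//; lra.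
Qed.

Lemma trust_prob_itv k : 0 <= trust_prob k <= 1.
Proof.
have [[h1 h h2 h3] _] := valid.2 k; rewrite /trust_prob.
by rewrite divr_ge0/= ?ler_pdivrMr; lra.
Qed.

Lemma leader_value_gt k : tcB2 P + tcE P < leader_value k.
Proof.
have [_ [h1 h h2 h3]] := valid.2 k; have := trust_prob_itv k.
by rewrite /leader_value; nra.
Qed.

(** Player 2 enters [k] and plays C with probability [trust_prob k]. T and WO then tie for player 1,
    and the favourable tie-break selects T. *)
Lemma exists_commitment k : exists q : mixed R (strat2 G),
  [/\ forall s : strat1 G, upure1 s q =
        if s.1 is Some j then (if j == k then tcN1 P k else tcB1 P)
        else tcB1 P + tcE P,
      forall s : strat1 G, upure2 s q =
        if s.1 is Some j then
          (if j == k then (if s.2 k then leader_value k else H2 k) else tcB2 P)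
        else tcB2 P,
      u1_br q = tcN1 P k & u2_fbr q = leader_value k].
Proof.
have [e0 vP] := valid.
have [[h1 _ h2 h3] [h4 _ h5 h6]] := vP k.
have [q qE] := two_point_mixed (Some k, [ffun=> true] : {ffun 'I_n -> bool})
  (Some k, [ffun=> false] : {ffun 'I_n -> bool}) (trust_prob_itv k).
have U1 (s : strat1 G) : upure1 s q =
    if s.1 is Some j then (if j == k then tcN1 P k else tcB1 P)
    else tcB1 P + tcE P.
  rewrite /upure1 qE /= /tc_pay1; case: s => [[j|] f] /=; last by ring.
  case: eqP => [->|_]; last by ring.
  rewrite /sub_pay1 !ffunE; case: (f k); last by ring.
  exact: trust_probE.
have U2 (s : strat1 G) : upure2 s q =
    if s.1 is Some j then
      (if j == k then (if s.2 k then leader_value k else H2 k) else tcB2 P)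
    else tcB2 P.
  rewrite /upure2 qE /= /tc_pay2; case: s => [[j|] f] /=; last by ring.
  case: eqP => [->|_]; last by ring.
  by rewrite /sub_pay2 !ffunE; case: (f k) => //; ring.
have sbr : (Some k, [ffun=> true]) \in @br R G q.
  apply/brP => -[[j|] f]; rewrite !U1 /= eqxx; last exact: ltW.
  by case: ifP => // _; lra.
have sfbr : (Some k, [ffun=> true]) \in @fbr R G q.
  apply/fbrP; split=> // t _; rewrite !U2 /= eqxx ffunE.
  have := leader_value_gt k; case: t => [[j|] f] /=; last by lra.
  by case: ifP => // _; [case: ifP => // _|]; lra.
exists q; split=> //.
- by rewrite (u1_brE sbr) U1 /= eqxx.
- by rewrite (u2_fbrE sfbr) U2 /= eqxx ffunE.
Qed.

(** Player 2 faces simulation with probability [1 - x] and entering [a] with WO otherwise. The bound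
    is proved for each pure strategy [t] of player 2 separately, after adding, when the favourable
    response trusts, a multiple of player 1's incentive constraint. *)
Lemma leader_deviation_le (a : 'I_n) (x V : R) (q : mixed R (strat2 G)) :
  0 <= x <= 1 -> tcB2 P + tcE P <= V ->
  (1 - x) * leader_value a + x * H2 a <= V ->
  (forall k, k != a -> (1 - x) * leader_value k + x * tcB2 P <= V) ->
  (1 - x) * u2_fbr q + x * @upure2 R G (Some a, [ffun=> false]) q <= V.
Proof.
move=> /andP[x0 x1] V0 Va Vk.
have [e0 vP] := valid.
have [s sfbr] := @exists_fbr R G q; rewrite (u2_fbrE sfbr).
have /fbrP[/brP sbr _] := sfbr.
rewrite /upure2 !mulr_sumr -big_split /=.
under eq_bigr do rewrite mulrCA (mulrCA x) -mulrDr.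
have [_ [ha _ _ _]] := vP a.
have pay2a t : tc_pay2 P H2 (Some a, [ffun=> false]) t <= tcB2 P + oo_reward P t.1.
  rewrite /tc_pay2; case: t => [[j|] g] //=; rewrite addr0.
  by case: ifP => // /eqP; rewrite /sub_pay2 ffunE => _; exact: ltW.
have oo_le (b : option 'I_n) : oo_reward P b <= tcE P.
  by case: b => [j|] //=; exact: ltW.
(* If the response [s] does not trust in a subgame it enters, both branches pay at most [tcB2 P]
   plus the opt-out reward; this case is settled first. *)
have [[k [sk fk]]|noT] := pselect (exists k, s.1 = Some k /\ s.2 k); last first.
  apply: mixed_avg_le => t _.
  have : tc_pay2 P H2 s t <= tcB2 P + oo_reward P t.1.
    rewrite /tc_pay2; case: s noT {sfbr sbr} => [[j|] f] noT /=; last first.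
      by case: t => [[j|] g].
    case: t => [[l|] g] //=; rewrite addr0; case: ifP => // /eqP jl.
    rewrite /sub_pay2; case: ifP => [fj|_]; first by case: noT; exists j.
    by have [_ [hj _ _ _]] := vP j; exact: ltW.
  move: (pay2a t) (oo_le t.1) => pa ol ps.
  apply: le_trans V0; apply: le_trans (_ : tcB2 P + oo_reward P t.1 <= _); last first.
    by rewrite lerD2l.
  by nra.
have [[h1 _ h2 h3] [h4 _ h5 h6]] := vP k.
(* Player 1 weakly prefers T to WO, so [m] times this preference can be added to
   player 2's payoff; [m] makes C and D equally good for player 2. *)
pose m := (1 - x) * (tcA2 P k - tcG2 P k) / (tcG1 P k - tcH1 P k).
have m0 : 0 <= m by rewrite divr_ge0 ?mulr_ge0//; lra.
have mC : (1 - x) * tcG2 P k + m * (tcG1 P k - tcN1 P k) = (1 - x) * leader_value k.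
  rewrite /m /leader_value /trust_prob.
  by field; rewrite subr_eq0 gt_eqF//; lra.
have mD : (1 - x) * tcA2 P k + m * (tcH1 P k - tcN1 P k) = (1 - x) * leader_value k.
  rewrite /m /leader_value /trust_prob.
  by field; rewrite subr_eq0 gt_eqF//; lra.
have := sbr (set_second false k s); rewrite -subr_ge0 /upure1 -sumrB.
move=> /(mulr_ge0 m0); rewrite mulr_sumr => gain0.
rewrite -[leLHS]addr0; apply: le_trans (lerD (lexx _) gain0) _.
rewrite -big_split /=.
under eq_bigr do rewrite -mulrBr mulrCA -mulrDr.
apply: mixed_avg_le => t _.
(* A [t] entering [k] meets the unsimulated WO only if [k = a], which merges the two hypotheses on
   [V]. *)
have kV : (1 - x) * leader_value k + x * (if k == a then H2 a else tcB2 P) <= V.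
  by case: eqP => [->//|/eqP /Vk].
case: s sk fk {sfbr sbr gain0} => [_ f] /= -> fk.
case: t => [[j|] g]; rewrite /tc_pay1 /tc_pay2 /= ?addr0; last first.
  by rewrite subrr mulr0 addr0; lra.
rewrite /set_second /= [[ffun=> false] a]ffunE /sub_pay2 /sub_pay1 ffunE eqxx fk.
have [jk|nkj] := eqVneq k j.
  rewrite -jk eq_sym; move: kV; case: eqP => [ka|_] kV.
    by rewrite -?ka in kV *; case: (g _); lra.
  by case: (g k); lra.
rewrite subrr mulr0 addr0.
by case: ifP => _; nra.
Qed.

End TrustCoordination.

(** * Construction of the equilibrium and choice of the constants *)

(** The indifference conditions are hypotheses, separate from the choice of [x] and [y]. For player
    1, opting out pays [tcB1 P + tcE P] and entering [b] pays [tcB1 P + c]; the strict bound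
    involving [tcE P] and [c] rules out both. *)
Lemma msim_equilibrium (R : realType) (n : nat) (P : tc_payoffs R n) (H2 : 'I_n -> R)
    (a b : 'I_n) (x y c V1 V2 : R) :
  tc_valid P H2 -> b != a -> 0 <= x <= 1 ->
  (forall k, k != a -> leader_value P k <= leader_value P b) ->
  (1 - x) * leader_value P a + x * H2 a = V2 ->
  (1 - x) * leader_value P b + x * tcB2 P = V2 -> tcB2 P + tcE P < V2 ->
  0 < c -> y * (tcN1 P b - tcB1 P) = c ->
  y * (tcN1 P a - tcB1 P) + c < tcN1 P a - tcB1 P - tcE P ->
  (1 - y) * tcN1 P a + y * tcB1 P = V1 ->
  exists (mu : mixed R (option (strat1 (tc_game P H2))))
      (nu : probability (borel_mixed2 (tc_game P H2)) R),
    [/\ msim_NE c mu nu, msim_u1 c mu nu = V1 & msim_u2 mu nu = V2].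
Proof.
move=> valid ab x01 b_max V2a V2b V2_gt c_gt0 yb c_small V1E.
have [e0 vP] := valid.
have [[a1 _ a2 a3] _] := vP a.
have [[b1 _ b2 b3] _] := vP b.
have r0 : 0 < tcN1 P b - tcB1 P by lra.
have y0 : 0 <= y by rewrite -(pmulr_lge0 _ r0) yb ltW.
have ra0 : 0 < tcN1 P a - tcB1 P by lra.
have y1 : 0 <= 1 - y.
  by rewrite subr_ge0 -(ler_pM2r ra0); lra.
have y1E : (NngNum y1)%:num + (NngNum y0)%:num = 1 by rewrite /=; ring.
have [qa [Ua Wa Ba Fa]] := exists_commitment valid a.
have [qb [Ub Wb Bb Fb]] := exists_commitment valid b.
pose wo : strat1 (tc_game P H2) := (Some a, [ffun=> false]).
have [mu muE] := two_point_mixed (Some wo) None x01.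
pose nu : probability (borel_mixed2 (tc_game P H2)) R :=
  two_point_prob (T := borel_mixed2 (tc_game P H2)) qa qb y1E.
have I1 s :
    \int[nu]_q msim_pay1 c s q = (1 - y) * msim_pay1 c s qa + y * msim_pay1 c s qb.
  by rewrite Rintegral_two_point_prob//; exact: measurable_msim_pay1.
have I2 (s : option (strat1 (tc_game P H2))) :
    \int[nu]_q msim_pay2 s q = (1 - y) * msim_pay2 s qa + y * msim_pay2 s qb.
  by rewrite Rintegral_two_point_prob//; exact: measurable_msim_pay2.
(* Simulation adds [y * (tcN1 P b - tcB1 P)] over entering [a], which is exactly its cost [c]. *)
have I1sim : \int[nu]_q msim_pay1 c None q = V1.
  by rewrite I1 /= Ba Bb; lra.
have I1wo : \int[nu]_q msim_pay1 c (Some wo) q = V1.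
  by rewrite I1 /= Ua Ub /= eqxx eq_sym (negPf ab) V1E.
have u1mu : msim_u1 c mu nu = V1.
  by rewrite /msim_u1 muE I1sim I1wo; ring.
have u2mu : msim_u2 mu nu = V2.
  rewrite /msim_u2 muE !I2 /= Fa Fb Wa Wb /= eqxx ffunE eq_sym (negPf ab).
  transitivity ((1 - y) * V2 + y * V2); last by ring.
  by rewrite -{1}V2a -V2b; ring.
exists mu, nu; split=> //; split=> [mu'|nu'].
- rewrite u1mu; apply: mixed_avg_le => s _.
  case: s => [s|]; last by rewrite I1sim.
  rewrite I1 /= Ua Ub.
  case: (s.1) => [j|]; last by lra.
  have [->|ja] := eqVneq j a; first by rewrite eq_sym (negPf ab) V1E.
  have [jb|jb] := eqVneq j b; nra.
- rewrite u2mu /msim_u2 muE addrC; apply: Rintegral_msim_pay2_le => q.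
  apply: (leader_deviation_le valid) => //; first exact: ltW.
  + by rewrite V2a.
  + move=> k ka; rewrite -V2b lerD2r ler_wpM2l ?b_max//.
    by rewrite subr_ge0; case/andP: x01.
Qed.

Theorem theorem5p4 (R : realType) (n : nat) (P : tc_payoffs R n) :
  (0 < n)%N ->
  exists K : R, forall H2 : 'I_n -> R,
    tc_valid P H2 ->
    argmax (fun k => v2_SE (subgame P H2 k)) :&:
      argmax (fun k => v1_SE (subgame P H2 k)) = finset.set0 ->
    (forall k, H2 k <= K) ->
    msim_pareto_improving (tc_game P H2).
Proof.
(* With a single subgame both argmax sets are everything, contradicting (a), so any constant
   serves. *)
case: n P => [//|[|n]] P _.
  exists 0 => H2 _ /setP /(_ ord0).
  rewrite !inE => /negP[]; apply/andP.
  by split; apply/forallP => j; rewrite (ord1 j).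
have [a _ a_max] := @exists_argmax R _ (leader_value P) xpredT ord0 isT.
have [b0 b0a] : exists b0, b0 != a.
  have [->|] := eqVneq a ord0; first by exists ord_max.
  by exists ord0; rewrite eq_sym.
have [b ba b_max] := @exists_argmax R _ (leader_value P) (fun k => k != a) b0 b0a.
pose W := leader_value P b - tcB2 P.
pose D := leader_value P a - leader_value P b.
(* Player 2's payoff will be [tcB2 P + (1 - x) * W], so the goal is [x * W < W - tcE P]. For
   [x = D / (D + M)] with [M = tcB2 P - H2 a], this follows from [M > D * W / (W - tcE P)]; the
   added 1 gives strictness. *)
exists (tcB2 P - (D * W / (W - tcE P) + 1)) => H2 valid _ lowH2.
have [e0 vP] := valid.
have We : 0 < W - tcE P by have := leader_value_gt valid b; rewrite /W; lra.
have D0 : 0 <= D by rewrite subr_ge0 a_max.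
pose M := tcB2 P - H2 a.
have MDW : D * W + (W - tcE P) <= (W - tcE P) * M.
  have : D * W / (W - tcE P) + 1 <= M by have := lowH2 a; rewrite /M; lra.
  by rewrite -(ler_pM2l We) mulrDr mulr1 mulrC divfK ?gt_eqF.
have M0 : 0 < M by have [_ [h _ _ _]] := vP a; rewrite /M; lra.
(* The solution of player 2's indifference [(1 - x) * D = x * M]. *)
pose x := D / (D + M).
have DM : 0 < D + M by lra.
have xDM : x * (D + M) = D by rewrite divfK ?gt_eqF.
have x01 : 0 <= x <= 1 by rewrite divr_ge0/= ?ler_pdivrMr; lra.
have xW : x * W < W - tcE P.
  by rewrite /x mulrAC ltr_pdivrMr//; nra.
have [[a1 _ a2 a3] _] := vP a.
have [[b1 _ b2 b3] _] := vP b.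
pose ra := tcN1 P a - tcB1 P; pose rb := tcN1 P b - tcB1 P.
have rab : 0 < ra + rb by rewrite /ra /rb; lra.
have rb0 : 0 < rb by rewrite /rb; lra.
(* With [y = c / rb], the requirement [y * ra + c < ra - tcE P] is exactly that [c] lies below this
   threshold. *)
exists ((ra - tcE P) * rb / (ra + rb)).
  by rewrite divr_gt0// mulr_gt0// /ra; lra.
move=> c /andP[c0 cc0].
have c_small : c / rb * ra + c < ra - tcE P.
  rewrite ltr_pdivlMr// in cc0.
  rewrite -(ltr_pM2r rb0) mulrDl mulrAC divfK ?gt_eqF//.
  by rewrite -mulrDr.
have yb : c / rb * rb = c by rewrite divfK ?gt_eqF.
have [||mu [nu [NE V1 V2]]] := @msim_equilibrium R _ P H2 a b x (c / rb) c _ _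
  valid ba x01 b_max _ (erefl _) _ c0 yb c_small (erefl _).
- have : (1 - x) * D = x * M by lra.
  by rewrite /D /M; lra.
- by move: xW; rewrite /W; lra.
exists mu, nu; split=> // p q /(tc_NE_payoffs valid)[p1 p2].
rewrite V1 V2; split; [apply: le_lt_trans p1 _|apply: le_lt_trans p2 _].
- by move: c_small; rewrite /ra /rb; set z := _ / _; lra.
- by move: xW; rewrite /W; lra.
Qed.
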